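(* Assume between-locality and that $\ell$ satisfies the SELF assumption with maps $\psi,\phi:[\mathcal X]\to\mathcal H$. Let $g^\star(\text y)=\mathbb E_{\text x\sim\pi_{\text y}}\phi(\text x)$, let $\widehat g:[\mathcal Y]\to\mathcal H$ be any measurable function, and let $\widehat{\bf x}$ be a measurable function with $$\widehat{\bf x}(y)\in\operatorname*{arg\,min}_{x\in\mathcal C_{B,\sigma}(y)}\frac1{|P|}\sum_{p\in P}\langle\psi(x_p),\widehat g(y_p)\rangle_{\mathcal H}.$$ Then $$\mathcal E(\widehat{\bf x})-\mathcal E({\bf x}^\star_\sigma)\le 2\,c_{B,\sigma}^{1/2}\Big(\mathbb E_{y\sim\rho_{\mathcal Y}}\|\widehat G(y)-G^\star(y)\|^2_{\mathcal H_P}\Big)^{1/2},\qquad c_{B,\sigma}=\mathbb E_{y\sim\rho_{\mathcal Y}}\operatorname{diam}^2\big(\Psi(\mathcal C_{B,\sigma}(y))\big).$$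
   Context: Setting: sharp images $x\in\mathcal X$, degraded images $y\in\mathcal Y$, finite patch index set $P$, patches $x_p\in[\mathcal X]$, $y_p\in[\mathcal Y]$ (fixed subsets of coordinates); $[\mathcal X]$ compact. $\rho$ distribution on pairs $(y,x)$, marginal $\rho_{\mathcal Y}$, conditional $\pi_y$. Patch loss $\ell$, $L(x,x')=\frac1{|P|}\sum_p\ell(x_p,x'_p)$, risk $\mathcal E({\bf x})=\mathbb E_{(y,x)\sim\rho}L({\bf x}(y),x)$. $B$ linear, $\sigma\ge0$, $\mathcal C_{B,\sigma}(y)=\{x\in\mathcal X:\|Bx-y\|_2\le\sigma\}$; ${\bf x}^\star_\sigma$ minimizes $\mathcal E$ over measurable ${\bf x}$ with ${\bf x}(y)\in\mathcal C_{B,\sigma}(y)$ for all $y$. Between-locality: for every $p$, $x_p$ is conditionally independent of $y$ given $y_p$, and there is a single conditional law $\pi_{\text y}$ on $[\mathcal X]$ such that for all $p$ the law of $x_p$ given $y_p=\text y$ is $\pi_{\text y}$. SELF assumption: there exist a separable Hilbert space $\mathcal H$ and continuous bounded maps $\psi,\phi:[\mathcal X]\to\mathcal H$ with $\ell(\text x,\text x')=\langle\psi(\text x),\phi(\text x')\rangle_{\mathcal H}$ for all $\text x,\text x'\in[\mathcal X]$. $\mathcal H_P$ is the space of families $(u_p)_{p\in P}$ in $\mathcal H$ with inner product $\langle u,v\rangle_{\mathcal H_P}=\frac1{|P|}\sum_{p}\langle u_p,v_p\rangle_{\mathcal H}$. $\Psi(x)=(\psi(x_p))_{p\in P}$, $G^\star(y)=(g^\star(y_p))_{p\in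 P}$, $\widehat G(y)=(\widehat g(y_p))_{p\in P}$. $\operatorname{diam}$ is the diameter in $\mathcal H_P$. *)

(* Defs.v *)
From HB Require Import structures.
From mathcomp Require Import all_boot all_order all_algebra.
From mathcomp Require Import all_classical all_reals all_analysis.

Set Implicit Arguments.
Unset Strict Implicit.
Unset Printing Implicit Defensive.

Import Order.TTheory GRing.Theory Num.Theory.
Import numFieldNormedType.Exports.

Local Open Scope classical_set_scope.
Local Open Scope ring_scope.

Section rV_borel.
Context {R : realType} (n : nat).

Definition rV_borel : set (set 'rV[R]_n) := <<s open >>.

Lemma rV_borel0 : rV_borel set0.
Proof. exact: sigma_algebra0. Qed.

Lemma rV_borelC (A : set 'rV[R]_n) : rV_borel A -> rV_borel (~` A).
Proof. by move=> hA; rewrite -setTD; exact: sigma_algebraCD. Qed.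

Lemma rV_borel_bigcup (F : (set 'rV[R]_n)^nat) :
  (forall i, rV_borel (F i)) -> rV_borel (\bigcup_i F i).
Proof. exact: sigma_algebra_bigcup. Qed.

HB.instance Definition _ := @isMeasurable.Build default_measure_display
  'rV[R]_n rV_borel rV_borel0 rV_borelC rV_borel_bigcup.

End rV_borel.

Section defs.
Context {R : realType}.

Definition l2norm (n : nat) (v : 'rV[R]_n) : R :=
  Num.sqrt (\sum_(i < n) (v ord0 i) ^+ 2).

Definition img_patch (n k : nat) (s : 'I_k -> 'I_n) (x : 'rV[R]_n) : 'rV[R]_k :=
  \row_(i < k) x ord0 (s i).

Definition Cset (n m : nat) (Xset : set 'rV[R]_n)
    (B : {linear 'rV[R]_n -> 'rV[R]_m}) (sigma : R) (y : 'rV[R]_m) :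
    set 'rV[R]_n :=
  [set x | Xset x /\ l2norm (B x - y) <= sigma].

Definition inner_product (H : normedModType R) (ip : H -> H -> R) : Prop :=
  [/\ forall u v, ip u v = ip v u,
      forall a u v w, ip (a *: u + v) w = a * ip u w + ip v w &
      forall u, ip u u = `|u| ^+ 2].

Definition separable (T : topologicalType) : Prop :=
  exists D : set T, countable D /\ closure D = setT.

Definition borel_measurable_fun d (T : measurableType d) (H : topologicalType)
    (D : set T) (f : T -> H) : Prop :=
  forall U : set H, open U -> measurable (D `&` f @^-1` U).

Definition bounded_on (T : Type) (H : normedModType R) (A : set T)
    (f : T -> H) : Prop :=
  exists M : R, forall x, A x -> `|f x| <= M.

(* expectation (Bochner/Pettis integral) of a Hilbert-valued map:           *)
(* v = E_{x ~ mu, x in A} f(x), characterised by <v, h> = E <f x, h>.      *)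
Definition is_expectation d (T : measurableType d) (H : normedModType R)
    (ip : H -> H -> R) (mu : set T -> \bar R) (A : set T) (f : T -> H)
    (v : H) : Prop :=
  forall h : H, (ip v h)%:E = (\int[mu]_(x in A) (ip (f x) h)%:E)%E.

Definition HP_inner (P : finType) (H : normedModType R) (ip : H -> H -> R)
    (u v : P -> H) : R :=
  #|P|%:R^-1 * \sum_(p : P) ip (u p) (v p).

Definition HP_norm (P : finType) (H : normedModType R) (ip : H -> H -> R)
    (u : P -> H) : R :=
  Num.sqrt (HP_inner ip u u).

Definition HP_diam (P : finType) (H : normedModType R) (ip : H -> H -> R)
    (A : set (P -> H)) : \bar R :=
  ereal_sup [set (HP_norm ip (fun p => u p - v p))%:E | u in A & v in A].

End defs.

(* Main.v *)
Require Import Defs.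
From HB Require Import structures.
From mathcomp Require Import all_boot all_order all_algebra.
From mathcomp Require Import all_classical all_reals all_analysis.
From mathcomp Require Import measurable_realfun ring lra.
Set Implicit Arguments.
Unset Strict Implicit.
Unset Printing Implicit Defensive.
Import Order.TTheory GRing.Theory Num.Theory.
Import numFieldNormedType.Exports.
Local Open Scope classical_set_scope.
Local Open Scope ring_scope.

(* Between-locality disintegrates the law of (y, x_p) as rho_Y (x) pi_{y_p}, so by the SELF factorisation the risk of any feasible xx is the integral of <Psi (xx y), G* y>. For y in Y, optimality of xhat y for the score <., Ghat y> gives
     <Psi (xhat y), G* y> - <Psi (xstar y), G* y>
       <= <Psi (xstar y) - Psi (xhat y), Ghat y - G* y>
       <= |Psi (xstar y) - Psi (xhat y)| |Ghat y - G* y|,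
   where the first factor is at most the diameter of Psi (C_{B,sigma} y); the Cauchy-Schwarz inequality for integrals concludes (even without the factor 2).
   Neither Y nor the diameter is assumed measurable. The integrals on the right-hand side are thus lower integrals, and comparing them on Y only requires that Y contain a Borel set of full measure, which inner regularity of rho provides. *)

(** * Integrals of nonmeasurable functions, and probability kernels *)

Import HBNNSimple.

(* For a nonnegative integrand that need not be measurable, [integral] is the lower integral: the supremum over the simple functions below it. *)
Lemma le_integral_ae_nonmeasurable d (T : measurableType d) (R : realType)
  (mu : {measure set T -> \bar R}) (f g : T -> \bar R) :
  (forall x, 0 <= f x)%E -> (forall x, 0 <= g x)%E ->
  {ae mu, forall x, (f x <= g x)%E} -> (\int[mu]_x f x <= \int[mu]_x g x)%E.
Proof.
move=> f0 g0 [N [mN N0 fgN]].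
rewrite ge0_integralTE// ge0_integralTE//.
apply: ge_ereal_sup => _ [s /= sf <-].
have mNC : measurable (~` N) by exact: measurableC.
(* Cutting [s] to zero on the null set [N] keeps its integral and yields a simple function that lies
   below [g] everywhere. *)
apply: (@le_trans _ _ (sintegral mu (proj_nnsfun s mNC))); last first.
  apply: ereal_sup_ubound; exists (proj_nnsfun s mNC) => //= x.
  rewrite mindicE; have [xN|xN] := boolP (x \in ~` N).
    rewrite mulr1; apply: le_trans (sf x) _.
    move: xN; rewrite inE /= => xN.
    by apply: contra_notP xN => fg; exact: fgN.
  by rewrite mulr0.
rewrite -!integralT_nnsfun; apply: ae_ge0_le_integral => //.
- by move=> x _; rewrite lee_fin.
- exact/measurable_EFinP.
- by move=> x _; rewrite lee_fin.
- exact/measurable_EFinP.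
exists N; split => // x /= xN; apply: contra_notP xN => xN _.
by rewrite lee_fin mindicE mem_set ?mulr1.
Qed.

Lemma integral_ae_nonmeasurable d (T : measurableType d) (R : realType)
  (mu : {measure set T -> \bar R}) (f g : T -> \bar R) :
  {ae mu, forall x, f x = g x} -> (\int[mu]_x f x = \int[mu]_x g x)%E.
Proof.
move=> fg; rewrite integralE [RHS]integralE.
(* Here [p] stands for the positive part or the negative part. *)
have fg' (p : (T -> \bar R) -> T -> \bar R) : (forall f x, (0 <= p f x)%E) ->
    (forall f g x, f x = g x -> p f x = p g x) ->
    (\int[mu]_x p f x = \int[mu]_x p g x)%E.
  move=> p0 pE; apply/eqP; rewrite eq_le; apply/andP; split;
    apply: le_integral_ae_nonmeasurable => //;
    by apply: filterS fg => x fgx; rewrite (pE _ _ _ fgx).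
by congr (_ - _)%E; apply: fg' => // h h' x hh; rewrite ?funeposE ?funenegE hh.
Qed.

Lemma bounded_integrable d (T : measurableType d) (R : realType)
  (mu : {measure set T -> \bar R}) (f : T -> R) (M : R) :
  (mu setT < +oo)%E -> measurable_fun setT f -> (forall x, `|f x| <= M) ->
  mu.-integrable setT (EFin \o f).
Proof.
move=> muT mf fM; apply: measurable_bounded_integrable => //.
exists M; split; first exact: num_real.
by move=> r Mr x _ /=; apply: le_trans (fM x) _; exact: ltW.
Qed.

(** Adding the bound [M] makes a bounded function nonnegative; this carries results on nonnegative
    integrands over to bounded signed ones. *)
Lemma integral_probability_addr d (T : measurableType d) (R : realType)
  (mu : {measure set T -> \bar R}) (f : T -> R) (M : R) :
  mu setT = 1%E -> measurable_fun setT f -> (forall x, `|f x| <= M) ->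
  (\int[mu]_x (f x + M)%:E = \int[mu]_x (f x)%:E + M%:E)%E.
Proof.
move=> muT mf fM; under eq_integral do rewrite EFinD.
rewrite integralD//.
- by rewrite integral_cst// muT mule1.
- by apply: (bounded_integrable _ mf fM); rewrite muT ltry.
- by apply: (@bounded_integrable _ _ _ _ (cst M) `|M|); rewrite ?muT ?ltry.
Qed.

Lemma abse_integral_probability_le d (T : measurableType d) (R : realType)
  (mu : {measure set T -> \bar R}) (f : T -> R) (M : R) :
  mu setT = 1%E -> measurable_fun setT f -> (forall x, `|f x| <= M) ->
  (`|\int[mu]_x (f x)%:E| <= M%:E)%E.
Proof.
move=> muT mf fM; apply: le_trans (le_abse_integral _ _ _) _ => //.
  exact/measurable_EFinP.
apply: (@le_trans _ _ (\int[mu]_x (cst M%:E x))%E).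
  apply: ge0_le_integral => //.
  - by apply: measurableT_comp => //; exact/measurable_EFinP.
  - by move=> x _; rewrite lee_fin fM.
by rewrite integral_cst// muT mule1.
Qed.

Lemma measurable_integral_kernel d1 d2 (Y : measurableType d1)
  (Z : measurableType d2) (R : realType) (k : R.-pker Y ~> Z)
  (h : Y * Z -> R) (M : R) :
  measurable_fun setT h -> (forall z, `|h z| <= M) ->
  measurable_fun setT (fun y => \int[k y]_z (h (y, z))%:E)%E.
Proof.
move=> mh hM.
rewrite (_ : (fun y => _) =
    (fun y => \int[k y]_z (h (y, z) + M)%:E - M%:E)%E); last first.
  apply/funext => y; rewrite (integral_probability_addr (mu := k y)) ?addeK//.
  - exact: prob_kernel.
  - exact: (measurableT_comp mh).
apply: emeasurable_funB => //.
apply: (@measurable_kfcomp _ _ _ _ _ k (fun z => (h z + M)%:E)).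
  by apply/measurable_EFinP; exact: measurable_funD.
move=> z; rewrite lee_fin -lerBlDr sub0r.
by have := hM z; rewrite ler_norml => /andP[].
Qed.

Lemma integral_linear_sum d (T : measurableType d) (R : realType)
  (mu : {measure set T -> \bar R}) (I : finType) (f : I -> T -> R) (a M : R) :
  (mu setT < +oo)%E -> (forall i, measurable_fun setT (f i)) ->
  (forall i x, `|f i x| <= M) ->
  mu.-integrable setT (fun x => (a * \sum_i f i x)%:E) /\
  (\int[mu]_x (a * \sum_i f i x)%:E = a%:E * \sum_i \int[mu]_x (f i x)%:E)%E.
Proof.
move=> muT mf fM.
have If i : mu.-integrable setT (fun x => (f i x)%:E).
  by apply: (@bounded_integrable _ _ _ mu _ M) => //; exact: fM.
have E : (fun x => (a * \sum_i f i x)%:E) = (fun x => a%:E * \sum_i (f i x)%:E)%E.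
  by apply/funext => x; rewrite EFinM sumEFin.
have Is : mu.-integrable setT (fun x => \sum_i (f i x)%:E)%E.
  by apply: integrable_sum => // i _; exact: If.
rewrite E; split; first exact: integrableZl.
by rewrite integralZl// integral_sum.
Qed.

(** * Disintegration of integrals along a probability kernel *)

Section disintegration.
Context d d1 d2 d3 (W : measurableType d) (Y : measurableType d1)
  (Z : measurableType d2) (V : measurableType d3) (R : realType).
Variables (P : probability W R) (f : W -> Y) (g : W -> Z) (t : Y -> V).
Variable k : R.-pker V ~> Z.
Hypotheses (mf : measurable_fun setT f) (mg : measurable_fun setT g).
Hypothesis mt : measurable_fun setT t.
Hypothesis fgk : forall A E, measurable A -> measurable E ->
  P (f @^-1` A `&` g @^-1` E) = (\int[pushforward P f]_(y in A) k (t y) E)%E.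

(* The canonical measure on [pushforward P f] depends on the proof [mf], so it is not inferred and has to be named. *)
Let nu : {measure set Y -> \bar R} :=
  measure_function_pushforward__canonical__measure_function_Measure P mf.

Let kt (y : Y) : {measure set Z -> \bar R} := k (t y).

Let mkt U : measurable U -> measurable_fun setT (kt ^~ U).
Proof. by move=> mU; exact: (measurableT_comp (measurable_kernel k U mU)). Qed.

HB.instance Definition _ := isKernel.Build _ _ _ _ R kt mkt.

Let ktT y : kt y setT = 1%E. Proof. by rewrite /kt prob_kernel. Qed.

HB.instance Definition _ := Kernel_isProbability.Build _ _ _ _ R kt ktT.

(** The measure [nu] seen as a kernel from a point, so that it can be composed with kernels. *)
Let l (_ : unit) : {measure set Y -> \bar R} := nu.

Let ml U : measurable U -> measurable_fun setT (l ^~ U).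
Proof. by move=> _; exact: measurable_cst. Qed.

HB.instance Definition _ := isKernel.Build _ _ _ _ R l ml.

Let lT u : l u setT = 1%E.
Proof. by rewrite /l /nu /= /pushforward preimage_setT probability_setT. Qed.

HB.instance Definition _ := Kernel_isProbability.Build _ _ _ _ R l lT.

Let mpair y : measurable_fun setT (pair y : Z -> Y * Z).
Proof. exact: pair1_measurable. Qed.

(** The product of the Dirac mass at [y] and [kt y]: the composition of [l] with [kk] is the joint
    law with marginal [nu] and conditional law [kt]. *)
Let kk (ty : unit * Y) : {measure set (Y * Z) -> \bar R} :=
  measure_function_pushforward__canonical__measure_function_Measure
    (kt ty.2) (mpair ty.2).

Let kkE u y U : kk (u, y) U = kt y (xsection U y).
Proof. by rewrite /kk /= /pushforward xsectionE. Qed.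

Let mkk U : measurable U -> measurable_fun setT (kk ^~ U).
Proof.
move=> mU.
rewrite (_ : kk ^~ U = (fun y => kt y (xsection U y)) \o snd); last first.
  by apply/funext => -[u y] /=; rewrite kkE.
apply: measurableT_comp => //.
by apply: measurable_fun_xsection_finite_kernel; rewrite inE.
Qed.

HB.instance Definition _ := isKernel.Build _ _ _ _ R kk mkk.

Let kkT u : kk u setT = 1%E.
Proof. by rewrite /kk /= /pushforward preimage_setT prob_kernel. Qed.

HB.instance Definition _ := Kernel_isProbability.Build _ _ _ _ R kk kkT.

(** By [fgk], the law of [(f, g)] and the composed kernel agree on measurable rectangles. These are
    stable under intersection and generate the product sigma-algebra, so the two measures
    coincide. *)
Lemma ge0_integral_disintegration (h : Y * Z -> \bar R) :
  (forall z, 0 <= h z)%E -> measurable_fun setT h ->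
  (\int[P]_w h (f w, g w) =
   \int[pushforward P f]_y \int[k (t y)]_z h (y, z))%E.
Proof.
move=> h0 mh.
have mfg : measurable_fun setT (fun w => (f w, g w)).
  exact: measurable_fun_pair.
transitivity (\int[pushforward P (fun w => (f w, g w))]_z h z)%E.
  by rewrite ge0_integral_pushforward.
transitivity (\int[kcomp l kk tt]_z h z)%E.
  apply: eq_measure_integral => A mA _ /=.
  apply: (measure_unique [set A `*` B | A in measurable & B in measurable]
    (fun=> setT)) => //.
  - exact: measurable_prod_measurableType.
  - move=> _ _ [X1 mX1 [X2 mX2 <-]] [Y1 mY1 [Y2 mY2 <-]].
    exists (X1 `&` Y1); first exact: measurableI.
    by exists (X2 `&` Y2); [exact: measurableI|rewrite setXI].
  - by move=> _; exists setT => //; exists setT => //; rewrite setXTT.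
  - by rewrite bigcup_const//; exists 0%N.
  - move=> _ [X1 mX1 [X2 mX2 <-]].
    transitivity (P (f @^-1` X1 `&` g @^-1` X2)); first by [].
    rewrite fgk// integral_mkcond; apply: eq_integral => y _.
    rewrite kkE patchE; case: ifPn => Xy.
      by rewrite in_xsectionX.
    by rewrite notin_xsectionX// measure0.
  - by move=> _; rewrite /= /pushforward preimage_setT probability_setT ltry.
rewrite integral_kcomp//; apply: eq_integral => y _.
by rewrite ge0_integral_pushforward.
Qed.

(** The nonnegative case is applied to [h + M], and [M] is cancelled on both sides because all the
    measures involved have mass one. *)
Lemma integral_disintegration (h : Y * Z -> R) (M : R) :
  measurable_fun setT h -> (forall z, `|h z| <= M) ->
  (\int[P]_w (h (f w, g w))%:E =
   \int[pushforward P f]_y \int[k (t y)]_z (h (y, z))%:E)%E.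
Proof.
move=> mh hM.
have mfg : measurable_fun setT (fun w => (f w, g w)).
  exact: measurable_fun_pair.
have mhy y : measurable_fun setT (fun z => h (y, z)).
  exact: (measurableT_comp mh).
have mhM : measurable_fun setT (fun z => (h z + M)%:E).
  by apply/measurable_EFinP; exact: measurable_funD.
have hM0 z : (0 <= (h z + M)%:E)%E.
  by rewrite lee_fin -lerBlDr sub0r; have := hM z; rewrite ler_norml => /andP[].
have I y : (kt y).-integrable setT (fun z => (h (y, z))%:E).
  by apply: (@bounded_integrable _ _ _ (kt y) _ M) => //; rewrite ktT ltry.
pose u y := fine (\int[k (t y)]_z (h (y, z))%:E).
have uE y : ((u y)%:E = \int[k (t y)]_z (h (y, z))%:E)%E.
  by rewrite fineK// (integrable_fin_num measurableT (I y)).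
have uM y : (\int[k (t y)]_z (h (y, z) + M)%:E = (u y + M)%:E)%E.
  by rewrite (integral_probability_addr (ktT y)) ?EFinD ?uE.
have mu : measurable_fun setT u.
  apply/measurable_EFinP.
  rewrite (_ : _ \o _ = (fun y => \int[kt y]_z (h (y, z))%:E)%E); last first.
    by apply/funext => y; rewrite /= uE.
  exact: measurable_integral_kernel mh hM.
have uB y : `|u y| <= M.
  rewrite -lee_fin -abse_EFin uE.
  by apply: (abse_integral_probability_le (ktT y) (mhy y)) => z; exact: hM.
have := ge0_integral_disintegration hM0 mhM.
under [X in _ = X -> _]eq_integral do rewrite uM.
rewrite (integral_probability_addr (f := fun w => h (f w, g w)))//; last 2 first.
- exact: probability_setT.
- exact: measurableT_comp.
rewrite (integral_probability_addr (mu := nu) (f := u))//; last first.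
  exact: (lT tt).
rewrite [X in _ -> _ = X](_ : _ = \int[nu]_y (u y)%:E)%E; last first.
  by apply: eq_integral => y _; rewrite uE.
move=> /(congr1 (fun x => x - M%:E)%E).
by rewrite !addeK.
Qed.

End disintegration.

(** * Measurability of maps into a separable Hilbert space *)

Section inner_product_theory.
Context {R : realType} {H : normedModType R} {ip : H -> H -> R}.
Hypothesis ipP : inner_product ip.

Lemma ipC u v : ip u v = ip v u. Proof. by case: ipP. Qed.

Lemma ipnorm u : ip u u = `|u| ^+ 2. Proof. by case: ipP. Qed.

Lemma ipDl u v w : ip (u + v) w = ip u w + ip v w.
Proof. by case: ipP => _ l _; have := l 1 u v w; rewrite scale1r mul1r. Qed.

Lemma ip0l w : ip 0 w = 0.
Proof. by apply: (addrI (ip 0 w)); rewrite -ipDl !addr0. Qed.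

Lemma ipZl a u w : ip (a *: u) w = a * ip u w.
Proof. by case: ipP => _ l _; have := l a u 0 w; rewrite addr0 ip0l addr0. Qed.

Lemma ipNl u w : ip (- u) w = - ip u w.
Proof. by rewrite -scaleN1r ipZl mulN1r. Qed.

Lemma ipBl u v w : ip (u - v) w = ip u w - ip v w.
Proof. by rewrite ipDl ipNl. Qed.

Lemma ip0r w : ip w 0 = 0. Proof. by rewrite ipC ip0l. Qed.

Lemma ipBr u v w : ip w (u - v) = ip w u - ip w v.
Proof. by rewrite ipC ipBl !(ipC w). Qed.

Lemma ip_normB u v : `|u - v| ^+ 2 = `|u| ^+ 2 + `|v| ^+ 2 - 2 * ip u v.
Proof. by rewrite -!ipnorm ipBl !ipBr (ipC v u); ring. Qed.

Lemma ip_cauchy_schwarz u v : `|ip u v| <= `|u| * `|v|.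
Proof.
have [->|v0] := eqVneq v 0; first by rewrite ip0r !normr0 mulr0.
have nv : 0 < `|v| by rewrite normr_gt0.
(* [c *: v] is the orthogonal projection of [u] on the line spanned by [v]. *)
pose c := ip u v / `|v| ^+ 2.
have : 0 <= `|u - c *: v| ^+ 2 by rewrite sqr_ge0.
rewrite ip_normB -(ipnorm (c *: v)) ipZl (ipC v) ipZl (ipC u (_ *: _)) ipZl.
rewrite (ipC v u) ipnorm => h.
rewrite -ler_sqr ?nnegrE ?mulr_ge0// real_normK ?num_real// exprMn.
have : c * `|v| ^+ 2 = ip u v by rewrite /c divfK// expf_neq0// gt_eqF.
move: (sqr_ge0 `|v|) h; nra.
Qed.

(** One direction is Cauchy-Schwarz. For the other, a term [e n] close to [v] makes [ip v (e n)]
    close to the square of the norm of [v]. *)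
Lemma norm_gt_ip (r : R) (e : nat -> H) (v : H) :
  (forall v (eps : R), 0 < eps -> exists n, `|v - e n| < eps) -> 0 <= r ->
  (r < `|v|) <-> (exists n, r * `|e n| < ip v (e n)).
Proof.
move=> ed r0; split=> [rv|[n]]; last first.
  rewrite ltNge => h; rewrite ltNge; apply: contra h => h.
  apply: le_trans (ler_norm _) _; apply: le_trans (ip_cauchy_schwarz _ _) _.
  by rewrite ler_wpM2r.
have v0 : 0 < `|v| by exact: le_lt_trans rv.
(* Writing [t] for the distance from [v] to [e n], the goal follows from
   [(r + |v|) * t < |v| * (|v| - r)]; [eps] is half of this threshold. *)
pose eps := `|v| * (`|v| - r) / (2 * (r + `|v|)).
have rv0 : 0 < r + `|v| by rewrite ltr_wpDl.
have e0 : 0 < eps.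
  by rewrite divr_gt0// ?mulr_gt0// subr_gt0.
have [n ne] := ed v _ e0; exists n.
have hn : `|e n| <= `|v| + `|v - e n|.
  by rewrite addrC distrC -[in leLHS](subrK v (e n)) ler_normD.
have := ip_cauchy_schwarz v (v - e n); rewrite ler_norml ipBr ipnorm.
move=> /andP[_].
have ee : eps * (2 * (r + `|v|)) = `|v| * (`|v| - r).
  by rewrite divfK// mulf_neq0// gt_eqF.
have : r * `|e n| <= r * (`|v| + `|v - e n|) by rewrite ler_wpM2l.
have : (r + `|v|) * `|v - e n| < (r + `|v|) * eps by rewrite ltr_pM2l.
have : 0 < `|v| * (`|v| - r) by rewrite mulr_gt0 // subr_gt0.
nra.
Qed.

End inner_product_theory.

Lemma separable_seq (R : realType) (H : normedModType R) : separable H ->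
  exists e : nat -> H, forall v (eps : R), 0 < eps -> exists n, `|v - e n| < eps.
Proof.
move=> [D [/countable_injP[f fD] Dd]].
(* The sequence inverts the injection [f]; indices outside its image get the harmless value 0. *)
exists (fun n => xget 0 [set d | D d /\ f d = n]) => v eps e0.
have : closure D v by rewrite Dd.
move=> /(_ (ball v eps)) /(_ (nbhsx_ballx _ _ e0)) [d [Dd' vd]].
exists (f d); case: xgetP => [d' _ [Dd1 ff]|/(_ d)/=]; last by case.
have <- : d = d' by apply: fD; rewrite ?inE.
by move: vd; rewrite -ball_normE.
Qed.

(** The weak form suits expectations, which are themselves characterised by scalar products with
    fixed vectors; separability then gives measurability of norms and of scalar products of two
    maps. *)
Definition weakly_measurable d (T : measurableType d) (R : realType)
    (H : normedModType R) (ip : H -> H -> R) (f : T -> H) : Prop :=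
  forall h, measurable_fun setT (fun x => ip (f x) h).

Section weak_measurability.
Context d (T : measurableType d) (R : realType) (H : normedModType R).
Context (ip : H -> H -> R).
Hypotheses (ipP : inner_product ip) (sepH : separable H).

Lemma weakly_measurableB (f g : T -> H) : weakly_measurable ip f ->
  weakly_measurable ip g -> weakly_measurable ip (fun x => f x - g x).
Proof.
move=> mf mg h; rewrite (_ : (fun x => _) =
  (fun x => ip (f x) h) \- (fun x => ip (g x) h)); last first.
  by apply/funext => x; rewrite (ipBl ipP).
exact: measurable_funB.
Qed.

(* The norm is the supremum of [ip v (e n) / `|e n|] over a dense sequence [e]. *)
Lemma weakly_measurable_norm (f : T -> H) : weakly_measurable ip f ->
  measurable_fun setT (fun x => `|f x|).
Proof.
move=> mf; apply: (measurability _ (RGenOInfty.measurableE R)) => //.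
move=> /= _ [_ [r ->] <-]; rewrite setTI.
have [e ed] := separable_seq sepH.
have [r0|r0] := ltP r 0.
  rewrite (_ : _ @^-1` _ = setT)//; apply/seteqP; split => // x _ /=.
  by rewrite in_itv/= andbT (lt_le_trans r0).
rewrite (_ : _ @^-1` _ =
    \bigcup_n [set x | r * `|e n| < ip (f x) (e n)]); last first.
  apply/seteqP; split => x /=; rewrite in_itv/= andbT.
    by move=> /(norm_gt_ip ipP _ ed r0)[n ?]; exists n.
  by move=> [n _ ?]; apply/(norm_gt_ip ipP _ ed r0); exists n.
apply: bigcupT_measurable => n.
have := mf (e n) measurableT `]r * `|e n|, +oo[%classic (measurable_itv _).
rewrite setTI; congr measurable; apply/seteqP.
by split => x /=; rewrite in_itv/= andbT.
Qed.

(** Polarisation expresses the scalar product through three norms, each of which is measurable. *)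
Lemma weakly_measurable_ip (f g : T -> H) : weakly_measurable ip f ->
  weakly_measurable ip g -> measurable_fun setT (fun x => ip (f x) (g x)).
Proof.
move=> mf mg.
rewrite (_ : (fun x => _) = (fun x => 2^-1 *
   (`|f x| ^+ 2 + `|g x| ^+ 2 - `|f x - g x| ^+ 2))); last first.
  by apply/funext => x; rewrite (ip_normB ipP); field.
apply: measurable_funM => //; apply: measurable_funB.
  by apply: measurable_funD; apply: measurable_funX;
    exact: weakly_measurable_norm.
by apply: measurable_funX; apply: weakly_measurable_norm;
  exact: weakly_measurableB.
Qed.

Lemma weakly_measurable_comp d' (S : measurableType d') (f : T -> H)
    (g : S -> T) : measurable_fun setT g -> weakly_measurable ip f ->
  weakly_measurable ip (f \o g).
Proof. by move=> mg mf h; exact: (measurableT_comp (mf h)). Qed.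

Lemma measurable_HP_norm (P : finType) (u v : P -> T -> H) :
  (forall p, weakly_measurable ip (u p)) ->
  (forall p, weakly_measurable ip (v p)) ->
  measurable_fun setT (fun x => HP_norm ip (fun p => u p x - v p x)).
Proof.
move=> mu mv; apply: (measurableT_comp (continuous_measurable_fun (@sqrt_continuous R))).
apply: measurable_funM => //; apply: measurable_sum => p.
by apply: weakly_measurable_ip; exact: weakly_measurableB.
Qed.

Lemma weakly_measurable_patch (D : set T) (f : T -> H) :
  measurable D -> (forall h, measurable_fun D (fun x => ip (f x) h)) ->
  weakly_measurable ip (patch (fun=> 0) D f).
Proof.
move=> mD mf h.
rewrite (_ : (fun x => _) = (fun x => ip (f x) h) \_ D); last first.
  by apply/funext => x; rewrite /patch; case: ifP => // _; rewrite (ip0l ipP).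
by apply/(measurable_restrictT _ mD).
Qed.

Lemma borel_weakly_measurable (D : set T) (f : T -> H) :
  borel_measurable_fun D f -> weakly_measurable ip (patch (fun=> 0) D f).
Proof.
move=> mf; have mD : measurable D.
  have := mf setT openT; rewrite preimage_setT setIT; exact.
apply: weakly_measurable_patch => // h.
apply: (measurability _ (RGenOpens.measurableE R)) => _ /= [_ [a [b ->]] <-].
rewrite (_ : _ @^-1` _ = f @^-1` [set v | ip v h \in `]a, b[]); last by [].
apply: mf.
have cip : continuous (ip ^~ h).
  move=> v; apply/cvgrPdist_lt => eps e0.
  (* The summand 1 covers the case [h = 0]. *)
  have d0 : 0 < eps / (`|h| + 1) by rewrite divr_gt0// ltr_wpDl.
  apply: filterS (nbhs_ball_norm v (PosNum d0)) => w /=.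
  rewrite ltr_pdivlMr ?ltr_wpDl// => h1; apply: le_lt_trans h1.
  rewrite -(ipBl ipP); apply: le_trans (ip_cauchy_schwarz ipP _ _) _.
  by rewrite ler_wpM2l// lerDl.
rewrite (_ : [set v | _] = (ip ^~ h) @^-1` `]a, b[%classic); last by [].
by apply: open_comp => // v _; exact: cip.
Qed.

End weak_measurability.

(** * Inner regularity *)

Section inner_approximation.
Context d (T : measurableType d) (R : realType).
Variables (mu : {finite_measure set T -> \bar R}) (C : set (set T)).
Hypotheses (C0 : C set0) (CT : C setT)
  (CU : forall A B, C A -> C B -> C (A `|` B))
  (CI : forall F : (set T)^nat, (forall i, C (F i)) -> C (\bigcap_i F i))
  (Cm : C `<=` measurable).

(** Inner regularity of [A] with respect to the class [C], which later consists of measurable closed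
    sets. *)
Definition inner_approx (A : set T) : Prop := forall eps : R, 0 < eps ->
  exists K, [/\ C K, K `<=` A & (mu (A `\` K) <= eps%:E)%E].

Let choose_approx (F : (set T)^nat) (eps : R) : 0 < eps ->
  (forall i, inner_approx (F i)) ->
  exists K : (set T)^nat, forall i,
    [/\ C (K i), K i `<=` F i & (mu (F i `\` K i) <= (eps / (2 ^ i.+1)%:R)%:E)%E].
Proof.
move=> e0 aF.
have ch i : exists K, [/\ C K, K `<=` F i &
    (mu (F i `\` K) <= (eps / (2 ^ i.+1)%:R)%:E)%E].
  by apply: aF; rewrite divr_gt0// ltr0n expn_gt0.
by exists (fun i => sval (cid (ch i))) => i; exact: (svalP (cid (ch i))).
Qed.

Let mu_bigcup_approx (F K : (set T)^nat) (eps : R) (X : set T) : 0 < eps ->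
  (forall i, measurable (F i)) ->
  (forall i, [/\ C (K i), K i `<=` F i &
    (mu (F i `\` K i) <= (eps / (2 ^ i.+1)%:R)%:E)%E]) ->
  measurable X -> X `<=` \bigcup_i (F i `\` K i) -> (mu X <= eps%:E)%E.
Proof.
move=> e0 mF hK mX XU.
have mFK i : measurable (F i `\` K i).
  by apply: measurableD => //; apply: Cm; case: (hK i).
apply: (@le_trans _ _ (\sum_(i <oo) mu (F i `\` K i))%E).
  exact: measure_sigma_subadditive.
apply: (@le_trans _ _ (\sum_(i <oo) (eps / (2 ^ i.+1)%:R)%:E)%E).
  by apply: lee_nneseries => // i _; case: (hK i).
by apply: (epsilon_trick0 xpredT); exact: ltW.
Qed.

(** What the intersection of the [K i] misses is covered by the sets left over in each [F i], whose
    measures sum to at most [eps]. *)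
Lemma inner_approx_bigcap (F : (set T)^nat) : (forall i, measurable (F i)) ->
  (forall i, inner_approx (F i)) -> inner_approx (\bigcap_i F i).
Proof.
move=> mF aF eps e0; have [K hK] := choose_approx e0 aF.
have mK i : measurable (K i) by apply: Cm; case: (hK i).
exists (\bigcap_i K i); split.
- by apply: CI => i; case: (hK i).
- by move=> x Kx i _; case: (hK i) => _ KF _; apply: KF; exact: Kx.
apply: (mu_bigcup_approx e0 mF hK).
  by apply: measurableD; exact: bigcapT_measurable.
move=> x [Fx /existsNP[i /not_implyP[_ Kx]]]; exists i => //.
by split => //; exact: Fx.
Qed.

(** [C] is stable under finite unions only, so the union of the [K i] is truncated, by continuity of
    the finite measure from above. Starting from [eps / 2] leaves room for the truncation. *)
Lemma inner_approx_bigcup (F : (set T)^nat) : (forall i, measurable (F i)) ->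
  (forall i, inner_approx (F i)) -> inner_approx (\bigcup_i F i).
Proof.
move=> mF aF eps e0; have e20 : 0 < eps / 2 by rewrite divr_gt0.
have [K hK] := choose_approx e20 aF.
have mK i : measurable (K i) by apply: Cm; case: (hK i).
pose G n := \bigcup_i F i `\` \bigcup_(i < n) K i.
have mG n : measurable (G n).
  by apply: measurableD; [exact: bigcupT_measurable|exact: bigcup_measurable].
have GE : \bigcap_n G n = \bigcup_i F i `\` \bigcup_i K i.
  apply/seteqP; split => x.
    move=> Gx; split; first by case: (Gx 0%N I).
    by move=> [i _ Kx]; have [_] := Gx i.+1 I; apply; exists i => /=.
  by move=> [Fx Kx] n _; split => // -[i _ ?]; apply: Kx; exists i.
have : mu \o G @ \oo --> mu (\bigcap_n G n).
  apply: nonincreasing_cvg_mu => //.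
  - by rewrite ltey_eq fin_num_measure.
  - exact: bigcapT_measurable.
  - move=> n m nm; apply/subsetPset => x [Fx Kx]; split => // -[i /= im Ki].
    by apply: Kx; exists i => //=; exact: leq_trans im nm.
have Glt : (mu (\bigcap_n G n) < eps%:E)%E.
  apply: (@le_lt_trans _ _ (eps / 2)%:E); last first.
    by rewrite lte_fin ltr_pdivrMr// mulr_natr mulr2n ltrDl.
  apply: (mu_bigcup_approx e20 mF hK); first exact: bigcapT_measurable.
  rewrite GE => x [[i _ Fx] Kx]; exists i => //; split => // Ki.
  by apply: Kx; exists i.
move=> /(_ [set y | (y < eps%:E)%E]) [].
  by apply: open_nbhs_nbhs; split => //; exact: open_ereal_lt_ereal.
move=> N _ /(_ N (leqnn N)) /= GN.
exists (\bigcup_(i < N) K i); split.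
- rewrite bigcup_mkord; elim/big_ind : _ => // i _; by case: (hK i).
- by move=> x [i _ Kx]; exists i => //; case: (hK i) => _ KF _; exact: KF.
- exact: ltW.
Qed.

(** Requiring approximation of both the set and its complement makes the class stable under
    complements; countable unions then use both preceding lemmas. *)
Lemma sigma_algebra_inner_approx : sigma_algebra setT
  [set A | [/\ measurable A, inner_approx A & inner_approx (~` A)]].
Proof.
have aC A : C A -> inner_approx A.
  move=> CA eps e0; exists A; split => //.
  by rewrite setDv measure0 lee_fin ltW.
split => /=.
- by split => //; [exact: aC|rewrite setC0; exact: aC].
- move=> A [mA aA aCA]; rewrite setTD; split => //; last by rewrite setCK.
  exact: measurableC.
- move=> F hF; split.
  + by apply: bigcupT_measurable => i; case: (hF i).
  + by apply: inner_approx_bigcup => i; case: (hF i).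
  + rewrite setC_bigcup; apply: inner_approx_bigcap => i; case: (hF i) => // mF _ _.
    exact: measurableC.
Qed.

End inner_approximation.

(** * Topology and Borel sets of row vectors *)

Lemma open_bigcup_closed (R : realType) (V : normedModType R) (A : set V) :
  open A -> exists F : (set V)^nat, (forall i, closed (F i)) /\ A = \bigcup_i F i.
Proof.
(* The points at distance at least [1 / (n + 1)] from every point of the complement of [A]. *)
move=> oA; exists (fun n => \bigcap_(y in ~` A) ~` ball_ Num.norm y n.+1%:R^-1).
split=> [n|].
  apply: closed_bigI => y _; apply: open_closedC.
  by rewrite ball_normE; apply: ball_open; rewrite invr_gt0.
apply/seteqP; split=> [x Ax|x [n _ nx]]; last first.
  by apply: contrapT => xA; apply: (nx x xA); rewrite /= subrr normr0 invr_gt0.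
have /nbhs_ballP[e /= e0 eA] : nbhs x A by exact: open_nbhs_nbhs.
have [N _ /(_ N (leqnn N)) /= Ne] := near_infty_natSinv_lt (PosNum e0).
exists N => // y yA /= yx; apply: yA; apply: eA; rewrite -ball_normE /=.
by rewrite distrC; exact: lt_trans Ne.
Qed.

Lemma measurable_rV_open (R : realType) n (A : set 'rV[R]_n) :
  open A -> measurable A.
Proof. by move=> oA; exact: sub_sigma_algebra. Qed.

Lemma measurable_rV_closed (R : realType) n (A : set 'rV[R]_n) :
  closed A -> measurable A.
Proof.
move=> cA; rewrite -(setCK A); apply: measurableC; apply: measurable_rV_open.
exact: closed_openC.
Qed.

Lemma continuous_measurable_rV (R : realType) n k (f : 'rV[R]_n -> 'rV[R]_k) :
  continuous f -> measurable_fun setT f.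
Proof.
move=> cf; apply: (@measurability _ _ 'rV[R]_n 'rV[R]_k setT f open) => //.
move=> _ [B oB <-]; rewrite setTI; apply: measurable_rV_open.
by move/continuousP: cf; exact.
Qed.

Lemma measurable_img_patch (R : realType) n k (s : 'I_k -> 'I_n) :
  measurable_fun setT (@img_patch R n k s).
Proof.
apply: continuous_measurable_rV => x A /nbhs_ballP[e e0 eA].
apply/nbhs_ballP; exists e => //= y [_ xy]; apply: eA; split => // i j.
by rewrite !mxE; exact: xy.
Qed.

Lemma continuous_borel_measurable (R : realType) n (H : topologicalType)
    (D : set 'rV[R]_n) (f : 'rV[R]_n -> H) :
  compact D -> {within D, continuous f} -> borel_measurable_fun D f.
Proof.
move=> cD /continuousP cf U oU.
have /open_subspaceP[V oV VD] := cf U oU.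
rewrite setIC -VD; apply: measurableI; first exact: measurable_rV_open.
by apply: measurable_rV_closed; exact: compact_closed.
Qed.

Lemma bigcup_compact_setT (R : realType) n :
  exists K : (set 'rV[R]_n)^nat, (forall i, compact (K i)) /\ \bigcup_i K i = setT.
Proof.
exists (fun i => [set v : 'rV[R]_n | forall j, v ord0 j \in `[(- i%:R), i%:R]]).
split=> [i|].
  apply: (@rV_compact R n (fun=> `[(- i%:R), i%:R]%classic)) => _.
  exact: segment_compact.
apply/seteqP; split => // v _.
(* The sum of the absolute values bounds every coordinate at once. *)
exists (Num.bound (\sum_j `|v ord0 j|)) => //= j.
rewrite in_itv /= -ler_norml; apply/ltW/(le_lt_trans _ (archi_boundP _)).
  by rewrite (bigD1 j)//= lerDl sumr_ge0.
by rewrite sumr_ge0.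
Qed.

(** * Projections of sets of full measure *)

Section sigma_compact_projection.
Context {R : realType} (m n : nat).
Variable rho : probability ('rV[R]_m * 'rV[R]_n)%type R.

(** Both conditions are imposed: closedness refers to the product topology, measurability to the
    product sigma-algebra. *)
Let C := [set A : set ('rV[R]_m * 'rV[R]_n) | closed A /\ measurable A].

Let S := [set A | [/\ measurable A, inner_approx rho C A & inner_approx rho C (~` A)]].

Let sS : sigma_algebra setT S.
Proof.
apply: sigma_algebra_inner_approx.
- by split; [exact: closed0|exact: measurable0].
- by split; [exact: closedT|exact: measurableT].
- by move=> A B [cA mA] [cB mB]; split; [exact: closedU|exact: measurableU].
- move=> F CF; split; last by apply: bigcapT_measurable => i; case: (CF i).
  by apply: closed_bigI => i _; case: (CF i).
- by move=> A [].
Qed.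

(** It suffices to treat open sets. An open set is a countable union of closed ones, whose preimages
    lie in [C], and the preimage of its complement lies in [C] too. *)
Let S_preimage k (f : 'rV[R]_m * 'rV[R]_n -> 'rV[R]_k) : continuous f ->
  measurable_fun setT f -> forall A, measurable A -> S (f @^-1` A).
Proof.
move=> cf mf; have mfi A : measurable A -> measurable (f @^-1` A).
  by move=> mA; rewrite -[X in measurable X]setTI; exact: mf.
apply: smallest_sub; first split => /=.
- by rewrite preimage_set0; case: sS.
- by move=> A SA; rewrite setTD preimage_setC -setTD; case: sS => _ + _; exact.
- by move=> F SF; rewrite preimage_bigcup; case: sS => _ _; exact.
move=> A oA.
have aC B : closed B -> inner_approx rho C (f @^-1` B).
  move=> cB eps e0; exists (f @^-1` B); split => //.
  - split; first by apply: preimage_closed => // x _; exact: cf.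
    by apply: mfi; exact: measurable_rV_closed.
  - by rewrite setDv measure0 lee_fin ltW.
split.
- by apply: mfi; exact: measurable_rV_open.
- have [F [cF ->]] := open_bigcup_closed oA.
  rewrite preimage_bigcup; apply: inner_approx_bigcup => //.
  + by split; [exact: closed0|exact: measurable0].
  + by move=> B D [cB mB] [cD mD]; split; [exact: closedU|exact: measurableU].
  + by move=> B [].
  + by move=> i; apply: mfi; exact: measurable_rV_closed.
  + by move=> i; exact: aC.
- by rewrite preimage_setC; apply: aC; exact: open_closedC.
Qed.

Let measurable_approx E : measurable E -> inner_approx rho C E.
Proof.
move=> mE; suff : S E by case.
move: E mE; apply: smallest_sub => //.
move=> _ [|] [A mA <-]; rewrite setTI; apply: S_preimage => //.
- by move=> x; exact: cvg_fst.
- by move=> x; exact: cvg_snd.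
Qed.

(* The projection of a Borel set need not be Borel, but inner regularity provides a sigma-compact subset of full measure, whose projection is again sigma-compact. *)
Lemma ae_fst_pushforward (D : set 'rV[R]_m) (E : set ('rV[R]_m * 'rV[R]_n)) :
  {ae rho, forall z, E z} -> (forall z, E z -> D z.1) ->
  {ae pushforward rho fst, forall y, D y}.
Proof.
move=> [N [mN N0 EN]] ED.
have NE z : ~ N z -> E z by apply: contra_notP => nE; exact: EN.
have ch i : exists K, [/\ C K, K `<=` ~` N & (rho (~` N `\` K) <= (i.+1%:R^-1)%:E)%E].
  by apply: measurable_approx; [exact: measurableC|rewrite invr_gt0].
pose K i := sval (cid (ch i)).
have hK i : [/\ C (K i), K i `<=` ~` N & (rho (~` N `\` K i) <= (i.+1%:R^-1)%:E)%E].
  exact: svalP (cid (ch i)).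
have [A [cA AT]] := bigcup_compact_setT R m.
have [B [cB BT]] := bigcup_compact_setT R n.
(* Intersecting with compact boxes makes each piece compact, so its projection is compact, hence
   Borel. *)
pose Y0 := \bigcup_i \bigcup_j \bigcup_l (fst @` (K i `&` (A j `*` B l))).
have mY0 : measurable Y0.
  apply: bigcupT_measurable => i; apply: bigcupT_measurable => j.
  apply: bigcupT_measurable => l; apply: measurable_rV_closed.
  apply: compact_closed => //; apply: continuous_compact.
    by apply: continuous_subspaceT => x; exact: cvg_fst.
  rewrite setIC; apply: compact_closedI; first exact: compact_setX.
  by case: (hK i) => -[].
have Y0D : Y0 `<=` D.
  move=> _ [i _ [j _ [l _ [z [Kz _] <-]]]].
  by apply: ED; apply: NE; case: (hK i) => _ KN _; exact: KN.
exists (~` Y0); split; [exact: measurableC| |exact: subsetC].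
rewrite /pushforward; apply/eqP; rewrite eq_le measure_ge0 andbT.
have mfY : measurable (fst @^-1` (~` Y0) : set ('rV[R]_m * 'rV[R]_n)).
  by rewrite -[X in measurable X]setTI; apply: measurable_fst => //; exact: measurableC.
have mK i : measurable (K i) by case: (hK i) => -[].
apply/lee_addgt0Pr => eps e0; rewrite add0e.
have [i _ /(_ i (leqnn i)) /= ie] := near_infty_natSinv_lt (PosNum e0).
(* A point projecting outside [Y0] lies in no [K i], hence in [N] or in the remainder of [K i], for
   every [i]. *)
apply: (@le_trans _ _ (rho N + rho (~` N `\` K i))%E); last first.
  rewrite [X in (X + _)%E]N0 add0e; case: (hK i) => _ _ h; apply: le_trans h _.
  by rewrite lee_fin ltW.
apply: le_trans (measureU2 _ _ _) => //; last first.
  by apply: measurableD => //; exact: measurableC.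
apply: le_measure; rewrite ?inE//.
  by apply: measurableU => //; apply: measurableD => //; exact: measurableC.
move=> z /= Yz; have [Nz|Nz] := pselect (N z); [by left|right; split => // Kz].
apply: Yz.
have [j _ Aj] : (\bigcup_i A i) z.1 by rewrite AT.
have [l _ Bl] : (\bigcup_i B i) z.2 by rewrite BT.
by exists i => //; exists j => //; exists l => //; exists z.
Qed.

End sigma_compact_projection.

(** * The Hilbert space of families *)

Section HP_theory.
Context {R : realType} {H : normedModType R} {ip : H -> H -> R} (P : finType).
Hypothesis ipP : inner_product ip.
Implicit Types u v : P -> H.

Lemma HP_inner_ge0 u : 0 <= HP_inner ip u u.
Proof.
rewrite mulr_ge0 ?invr_ge0//; apply: sumr_ge0 => p _.
by rewrite (ipnorm ipP) sqr_ge0.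
Qed.

Lemma HP_norm_ge0 u : 0 <= HP_norm ip u.
Proof. exact: sqrtr_ge0. Qed.

Lemma HP_inner_quadratic u v (t : R) :
  HP_inner ip (fun p => u p - t *: v p) (fun p => u p - t *: v p) =
  HP_inner ip u u - 2 * t * HP_inner ip u v + t ^+ 2 * HP_inner ip v v.
Proof.
rewrite /HP_inner -[2 * t * _]mulrCA -[t ^+ 2 * _]mulrCA -mulrBr -mulrDr.
congr (_ * _); rewrite !mulr_sumr -sumrB -big_split; apply: eq_bigr => p _ /=.
rewrite (ipBl ipP) !(ipBr ipP) !(ipZl ipP) !(ipC ipP _ (t *: _)) !(ipZl ipP).
by rewrite (ipC ipP (v p) (u p)); ring.
Qed.

Lemma HP_cauchy_schwarz u v :
  HP_inner ip u v <= HP_norm ip u * HP_norm ip v.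
Proof.
have q t := HP_inner_quadratic u v t.
have q0 t := HP_inner_ge0 (fun p => u p - t *: v p).
rewrite /HP_norm -sqrtrM ?HP_inner_ge0//.
have := HP_inner_ge0 u; have := HP_inner_ge0 v.
set a := HP_inner ip u u in q *; set b := HP_inner ip u v in q *.
set c := HP_inner ip v v in q *.
rewrite le_eqVlt => /predU1P[c0|c0] a0.
  have [b0|b0] := leP b 0; first by apply: le_trans b0 _; exact: sqrtr_ge0.
  (* With [c = 0] the quadratic is affine in [t]; at this [t] it takes the value -1, a
     contradiction. *)
  have := q0 ((a + 1) / (2 * b)); rewrite q -c0.
  have -> : 2 * ((a + 1) / (2 * b)) * b = a + 1.
    by field; rewrite gt_eqF.
  lra.
(* [b / c] minimises the quadratic. *)
have := q0 (b / c); rewrite q => h.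
apply: le_trans (ler_norm _) _; rewrite -sqrtr_sqr ler_wsqrtr//.
have e : a - 2 * (b / c) * b + (b / c) ^+ 2 * c = a - b ^+ 2 / c.
  by field; rewrite gt_eqF.
by move: h; rewrite e subr_ge0 ler_pdivrMr.
Qed.

End HP_theory.

(** * Cauchy-Schwarz for integrals and the excess risk bound *)

Lemma integral_cauchy_schwarz d (T : measurableType d) (R : realType)
  (mu : {measure set T -> \bar R}) (f g : T -> R) :
  measurable_fun setT f -> measurable_fun setT g ->
  (forall x, 0 <= f x) -> (forall x, 0 <= g x) ->
  (\int[mu]_x (f x * g x)%:E <=
   (\int[mu]_x (f x ^+ 2)%:E) `^ (2^-1)%R *
   (\int[mu]_x (g x ^+ 2)%:E) `^ (2^-1)%R)%E.
Proof.
move=> mf mg f0 g0.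
have := @hoelder _ _ _ mu f g 2 2 mf mg (ltr0n _ 2) (ltr0n _ 2).
have -> : 2^-1 + 2^-1 = 1 :> R by field.
move=> /(_ erefl).
have L2 h : (forall x, 0 <= h x) ->
    'N[mu]_2%:E[EFin \o h]%E = ((\int[mu]_x (h x ^+ 2)%:E) `^ (2^-1)%R)%E.
  move=> h0; rewrite unlock; congr (_ `^ _)%E; apply: eq_integral => x _ /=.
  by rewrite ger0_norm// powR_mulrn.
rewrite !L2// Lnorm1; congr (_ <= _)%E.
by apply: eq_integral => x _ /=; rewrite ger0_norm ?mulr_ge0.
Qed.

Theorem mainTheorem3
  (R : realType)
  (* images: sharp x in X ⊆ R^n, degraded y in Y ⊆ R^m;
     patches: x_p in [X] ⊆ R^k, y_p in [Y] ⊆ R^k' *)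
  (n m k k' : nat) (P : finType)
  (sX : P -> 'I_k -> 'I_n) (sY : P -> 'I_k' -> 'I_m)
  (Xset : set 'rV[R]_n) (Yset : set 'rV[R]_m)
  (PX : set 'rV[R]_k) (PY : set 'rV[R]_k')
  (* data distribution rho on pairs (y, x) and conditional law pi on [X] *)
  (rho : probability ('rV[R]_m * 'rV[R]_n)%type R)
  (pi : R.-pker 'rV[R]_k' ~> 'rV[R]_k)
  (* separable Hilbert space H and SELF maps psi, phi *)
  (H : completeNormedModType R) (ip : H -> H -> R)
  (ell : 'rV[R]_k -> 'rV[R]_k -> R) (psi phi : 'rV[R]_k -> H)
  (* degradation operator and noise level *)
  (B : {linear 'rV[R]_n -> 'rV[R]_m}) (sigma : R)
  (gstar ghat : 'rV[R]_k' -> H)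
  (xhat xstar : 'rV[R]_m -> 'rV[R]_n) :
  (* patches are fixed subsets of coordinates *)
  (forall p, injective (sX p)) ->
  (forall p, injective (sY p)) ->
  (forall x p, Xset x -> PX (img_patch (sX p) x)) ->
  (forall y p, Yset y -> PY (img_patch (sY p) y)) ->
  compact PX ->
  (* rho is a distribution on pairs (y, x) in Y x X *)
  {ae rho, forall z, Yset z.1 /\ Xset z.2} ->
  (* pi_y is a law on [X] *)
  (forall y, PY y -> pi y PX = 1%E) ->
  (* between-locality: for every p, the conditional law of x_p given y is
     pi_{y_p} (x_p independent of y given y_p, with conditional law pi) *)
  (forall p (A : set 'rV[R]_m) (E : set 'rV[R]_k),
     measurable A -> measurable E ->
     rho [set z | A z.1 /\ E (img_patch (sX p) z.2)] =
     (\int[pushforward rho fst]_(y in A) pi (img_patch (sY p) y) E)%E) ->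
  (* SELF assumption *)
  inner_product ip -> separable H ->
  {within PX, continuous psi} -> {within PX, continuous phi} ->
  bounded_on PX psi -> bounded_on PX phi ->
  (forall x x', PX x -> PX x' -> ell x x' = ip (psi x) (phi x')) ->
  0 <= sigma ->
  (* g*(y) = E_{x ~ pi_y} phi(x) *)
  (forall y, PY y -> is_expectation ip (pi y) PX phi (gstar y)) ->
  (* ghat measurable on [Y] *)
  borel_measurable_fun PY ghat ->
  (* xhat measurable, with xhat(y) in argmin over C_{B,sigma}(y) *)
  measurable_fun setT xhat ->
  (forall y, Yset y -> Cset Xset B sigma y (xhat y) /\
     forall x, Cset Xset B sigma y x ->
       #|P|%:R^-1 * \sum_(p : P) ip (psi (img_patch (sX p) (xhat y)))
                                    (ghat (img_patch (sY p) y))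
       <= #|P|%:R^-1 * \sum_(p : P) ip (psi (img_patch (sX p) x))
                                      (ghat (img_patch (sY p) y))) ->
  (* xstar = x*_sigma minimises the risk over measurable constrained maps *)
  let L := fun x x' : 'rV[R]_n =>
    #|P|%:R^-1 * \sum_(p : P) ell (img_patch (sX p) x) (img_patch (sX p) x') in
  let risk := fun xx : 'rV[R]_m -> 'rV[R]_n =>
    (\int[rho]_z (L (xx z.1) z.2)%:E)%E in
  measurable_fun setT xstar ->
  (forall y, Yset y -> Cset Xset B sigma y (xstar y)) ->
  (forall xx : 'rV[R]_m -> 'rV[R]_n, measurable_fun setT xx ->
     (forall y, Yset y -> Cset Xset B sigma y (xx y)) ->
     (risk xstar <= risk xx)%E) ->
  let Psi := fun x : 'rV[R]_n => fun p : P => psi (img_patch (sX p) x) in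
  let Gstar := fun y : 'rV[R]_m => fun p : P => gstar (img_patch (sY p) y) in
  let Ghat := fun y : 'rV[R]_m => fun p : P => ghat (img_patch (sY p) y) in
  let c := (\int[pushforward rho fst]_y
              (HP_diam ip (Psi @` Cset Xset B sigma y)) ^+ 2)%E in
  (risk xhat - risk xstar <=
   2%:E * c `^ (2^-1)%R *
   (\int[pushforward rho fst]_y
      ((HP_norm ip (fun p => Ghat y p - Gstar y p)) ^+ 2)%:E) `^ (2^-1)%R)%E.
Proof.
move=> _ _ XP YP cPX supp _ loc ipP sepH cpsi cphi [M1 hM1] [M2 hM2] ellE _ gE.
move=> mghat mxhat xhatP L risk mxstar xstarP _; cbv zeta.
set c := (X in (_ <= _ * X `^ _ * _)%E).
(* Hypotheses on the maps hold only on [PX] and [PY]; extension by zero gives weakly measurable maps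
   on the whole space and keeps the bounds. *)
pose psi0 : 'rV[R]_k -> H := patch (fun=> 0) PX psi.
pose phi0 : 'rV[R]_k -> H := patch (fun=> 0) PX phi.
pose gs : 'rV[R]_k' -> H := patch (fun=> 0) PY gstar.
pose gh : 'rV[R]_k' -> H := patch (fun=> 0) PY ghat.
pose pX p := @img_patch R n k (sX p); pose pY p := @img_patch R m k' (sY p).
have patchP T (D : set T) (f : T -> H) x : D x -> patch (fun=> 0) D f x = f x.
  by move=> Dx; rewrite /patch mem_set.
have patchB T (D : set T) (f : T -> H) M : (forall x, D x -> `|f x| <= M) ->
    forall x, `|patch (fun=> 0) D f x| <= `|M|.
  move=> fM x; rewrite /patch; case: ifPn => [/set_mem Dx|_].
    by apply: le_trans (fM _ Dx) _; exact: ler_norm.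
  by rewrite normr0.
have wpsi : weakly_measurable ip psi0.
  by apply: (borel_weakly_measurable ipP); exact: continuous_borel_measurable.
have wphi : weakly_measurable ip phi0.
  by apply: (borel_weakly_measurable ipP); exact: continuous_borel_measurable.
have wgh : weakly_measurable ip gh := borel_weakly_measurable ipP mghat.
have mPY : measurable PY.
  by have := mghat setT openT; rewrite preimage_setT setIT.
have bpsi := patchB _ _ _ _ hM1; have bphi := patchB _ _ _ _ hM2.
have bip u v a b : `|u| <= a -> `|v| <= b -> `|ip u v| <= a * b.
  move=> ua vb; apply: le_trans (ip_cauchy_schwarz ipP _ _) _.
  by rewrite ler_pM.
have gsE y h : PY y -> ((ip (gs y) h)%:E = \int[pi y]_x (ip (phi0 x) h)%:E)%E.
  move=> Py; rewrite [gs y]patchP// (gE y Py h) integral_mkcond.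
  apply: eq_integral => x _; rewrite /patch /phi0 /patch; case: ifP => // _.
  by rewrite (ip0l ipP).
(* On [PY], the scalar products of [gs] with fixed vectors are kernel integrals of bounded
   measurable functions. *)
have wgs : weakly_measurable ip gs.
  apply: (weakly_measurable_patch ipP mPY) => h; apply/measurable_EFinP.
  apply: (eq_measurable_fun (fun y => \int[pi y]_x (ip (phi0 x) h)%:E)%E).
    by move=> y /set_mem Py; rewrite -gsE//= [gs y]patchP.
  apply: measurable_funTS.
  apply: (@measurable_integral_kernel _ _ _ _ _ pi
    (fun yx => ip (phi0 yx.2) h) (`|M2| * `|h|)).
    exact: (measurableT_comp (wphi h)).
  by move=> z; exact: bip.
have bgs y : `|gs y| <= `|M2|.
  have [Py|nPy] := pselect (PY y); last by rewrite /gs /patch memNset// normr0.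
  have [->|g0] := eqVneq (gs y) 0; first by rewrite normr0.
  have gs0 : 0 < `|gs y| by rewrite normr_gt0.
  (* The squared norm of [gs y] is the expectation of [ip (phi0 x) (gs y)], so testing against
     [gs y] itself gives the bound. *)
  rewrite -(ler_pM2r gs0) -expr2 -(ipnorm ipP); apply: le_trans (ler_norm _) _.
  rewrite -lee_fin -abse_EFin gsE//.
  apply: abse_integral_probability_le.
  - exact: prob_kernel.
  - exact: wphi.
  - by move=> x; exact: bip.
pose nu : {measure set 'rV[R]_m -> \bar R} :=
  measure_function_pushforward__canonical__measure_function_Measure rho
    measurable_fst.
have nuT : (nu setT < +oo)%E.
  by rewrite /nu /= /pushforward preimage_setT probability_setT ltry.
have aeY : {ae nu, forall y, Yset y} by apply: (ae_fst_pushforward supp) => z [].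
pose F (xx : 'rV[R]_m -> 'rV[R]_n) y :=
  HP_inner ip (fun p => psi0 (pX p (xx y))) (fun p => gs (pY p y)).
have mpX p : measurable_fun setT (pX p) := @measurable_img_patch R n k (sX p).
have mpY p : measurable_fun setT (pY p) := @measurable_img_patch R m k' (sY p).
have riskE xx : measurable_fun setT xx -> (forall y, Yset y -> Xset (xx y)) ->
    nu.-integrable setT (fun y => (F xx y)%:E) /\
    risk xx = (\int[nu]_y (F xx y)%:E)%E.
  move=> mxx Xxx.
  have wxx p : weakly_measurable ip (fun y => psi0 (pX p (xx y))).
    apply: (weakly_measurable_comp _ wpsi).
    exact: (measurableT_comp (mpX p)).
  pose K p (yx : 'rV[R]_m * 'rV[R]_k) := ip (psi0 (pX p (xx yx.1))) (phi0 yx.2).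
  have mK p : measurable_fun setT (K p).
    apply: (weakly_measurable_ip ipP sepH).
      exact: (weakly_measurable_comp measurable_fst (wxx p)).
    exact: (weakly_measurable_comp measurable_snd wphi).
  have bK p z : `|K p z| <= `|M1| * `|M2| by exact: bip.
  have [IF FE] := @integral_linear_sum _ _ _ nu P
    (fun p y => ip (psi0 (pX p (xx y))) (gs (pY p y))) #|P|%:R^-1
    (`|M1| * `|M2|) nuT
    (fun p => weakly_measurable_ip ipP sepH (wxx p)
      (weakly_measurable_comp (mpY p) wgs))
    (fun p y => bip _ _ _ _ (bpsi _) (bgs _)).
  split => //; rewrite [RHS]FE.
  transitivity (\int[rho]_z
      (#|P|%:R^-1 * \sum_p K p (z.1, pX p z.2))%:E)%E.
    (* [ell] is constrained only on [PX], so the loss is replaced almost everywhere by the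
       measurable [K]. *)
    apply: integral_ae_nonmeasurable; apply: filterS supp => z [Yz Xz].
    rewrite /L; congr EFin; congr (_ * _); apply: eq_bigr => p _.
    by rewrite ellE ?/K/= ?[psi0 _]patchP ?[phi0 _]patchP//; apply: XP => //;
      exact: Xxx.
  have mz p : measurable_fun setT (fun z : 'rV[R]_m * 'rV[R]_n => (z.1, pX p z.2)).
    by apply: measurable_fun_pair => //; exact: (measurableT_comp (mpX p)).
  have [_ ->] := @integral_linear_sum _ _ _ rho P
    (fun p z => K p (z.1, pX p z.2)) #|P|%:R^-1 (`|M1| * `|M2|)
    (le_lt_trans (probability_le1 rho measurableT) (ltry 1))
    (fun p => measurableT_comp (mK p) (mz p)) (fun p z => bK p _).
  congr (_ * _)%E; apply: eq_bigr => p _.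
  rewrite (@integral_disintegration _ _ _ _ _ _ _ _ R rho fst
    (fun z => pX p z.2) (pY p) pi measurable_fst
    (measurableT_comp (mpX p) measurable_snd) (mpY p) (loc p) (K p) _
    (mK p) (bK p)).
  apply: (integral_ae_nonmeasurable (mu := nu)).
  apply: filterS aeY => y Yy; rewrite (ipC ipP) gsE; last exact: YP.
  by apply: eq_integral => x _; rewrite (ipC ipP).
have Xhat y : Yset y -> Xset (xhat y) by move=> /xhatP[[]].
have Xstar y : Yset y -> Xset (xstar y) by move=> /xstarP[].
have [Ihat ->] := riskE xhat mxhat Xhat.
have [Istar ->] := riskE xstar mxstar Xstar.
rewrite -integralB//.
pose u y p := psi0 (pX p (xstar y)); pose v y p := psi0 (pX p (xhat y)).
pose dd y := HP_norm ip (fun p => u y p - v y p).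
pose g y := HP_norm ip (fun p => gh (pY p y) - gs (pY p y)).
have mdd : measurable_fun setT dd.
  apply: (measurable_HP_norm ipP sepH (u := fun p y => u y p)
    (v := fun p y => v y p)) => p; apply: (weakly_measurable_comp _ wpsi);
  exact: (measurableT_comp (mpX p)).
have mg : measurable_fun setT g.
  by apply: (measurable_HP_norm ipP sepH (u := fun p y => gh (pY p y))
    (v := fun p y => gs (pY p y))) => p; exact: (weakly_measurable_comp (mpY p)).
have Fle y : Yset y -> F xhat y - F xstar y <= dd y * g y.
  move=> Yy; apply: le_trans (HP_cauchy_schwarz ipP _ _).
  have [_ /(_ _ (xstarP y Yy)) opt] := xhatP y Yy.
  have {}opt : HP_inner ip (v y) (fun p => gh (pY p y)) <=
               HP_inner ip (u y) (fun p => gh (pY p y)).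
    have E x : Xset x -> HP_inner ip (fun p => psi0 (pX p x))
        (fun p => gh (pY p y)) = #|P|%:R^-1 *
        \sum_p ip (psi (img_patch (sX p) x)) (ghat (img_patch (sY p) y)).
      move=> Xx; congr (_ * _); apply: eq_bigr => p _.
      by rewrite [psi0 _]patchP ?[gh _]patchP//; [exact: YP|exact: XP].
    by rewrite !E//; [exact: Xstar|exact: Xhat].
  (* By bilinearity the product splits into the gap in the score of [ghat], nonnegative by [opt],
     and the gap to be bounded. *)
  have -> : HP_inner ip (fun p => u y p - v y p)
                        (fun p => gh (pY p y) - gs (pY p y)) =
    HP_inner ip (u y) (fun p => gh (pY p y)) -
    HP_inner ip (v y) (fun p => gh (pY p y)) + (F xhat y - F xstar y).
    rewrite /F /HP_inner -!mulrBr -mulrDr -!sumrB -big_split; congr (_ * _).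
    apply: eq_bigr => p _; rewrite (ipBl ipP) !(ipBr ipP) /u /v /=; ring.
  by rewrite lerDr subr_ge0.
have c_ge : (\int[nu]_y (dd y ^+ 2)%:E <= c)%E.
  apply: (le_integral_ae_nonmeasurable (mu := nu)).
  - by move=> y; rewrite lee_fin sqr_ge0.
  - by move=> y; rewrite sqre_ge0.
  - apply: filterS aeY => y Yy.
    have h : ((dd y)%:E <= HP_diam ip ((fun x p => psi (pX p x)) @` Cset Xset B sigma y))%E.
      apply: ereal_sup_ubound; exists (fun p => psi (pX p (xstar y))).
        by exists (xstar y) => //; exact: xstarP.
      exists (fun p => psi (pX p (xhat y))).
        by exists (xhat y) => //; case: (xhatP y Yy).
      congr (HP_norm _ _)%:E; apply/funext => p.
      by rewrite /u /v ![psi0 _]patchP//; apply: XP; [exact: Xhat|exact: Xstar].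
    rewrite EFin_expe !expe2; apply: lee_pmul => //;
    by rewrite lee_fin HP_norm_ge0.
(* The integrands agree on [Yset]; outside [PY] the values of [gstar] are arbitrary, hence the
   comparison of lower integrals. *)
have G_ge : (\int[nu]_y (g y ^+ 2)%:E <= \int[nu]_y
    ((HP_norm ip (fun p => ghat (pY p y) - gstar (pY p y))) ^+ 2)%:E)%E.
  apply: (le_integral_ae_nonmeasurable (mu := nu)).
  - by move=> y; rewrite lee_fin sqr_ge0.
  - by move=> y; rewrite lee_fin sqr_ge0.
  - apply: filterS aeY => y Yy; rewrite le_eqVlt; apply/orP; left; apply/eqP.
    congr (_ ^+ 2)%:E; congr (HP_norm _ _); apply/funext => p.
    by rewrite [gh _]patchP ?[gs _]patchP//; exact: YP.
have c0 : (0 <= c)%E by rewrite /c integral_ge0// => y _; rewrite sqre_ge0.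
apply: (@le_trans _ _ (\int[nu]_y (dd y * g y)%:E)%E).
  (* The comparison of lower integrals applies to nonnegative integrands, so the signed difference
     is first bounded by its positive part. *)
  apply: (@le_trans _ _ (\int[nu]_y ((fun y => (F xhat y - F xstar y)%:E)^\+ y))%E).
    rewrite [leLHS]integralE; apply: geeDl; rewrite oppe_le0.
    by apply: integral_ge0 => y _; exact: funeneg_ge0.
  apply: (le_integral_ae_nonmeasurable (mu := nu)).
  - by move=> y; exact: funepos_ge0.
  - by move=> y; rewrite lee_fin mulr_ge0// HP_norm_ge0.
  - apply: filterS aeY => y Yy; rewrite funeposE ge_max !lee_fin Fle//=.
    by rewrite mulr_ge0// HP_norm_ge0.
apply: le_trans (integral_cauchy_schwarz nu mdd mg _ _) _.
- by move=> y; exact: HP_norm_ge0.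
- by move=> y; exact: HP_norm_ge0.
apply: lee_pmul; rewrite ?poweR_ge0//.
  apply: (@le_trans _ _ (c `^ (2^-1)%R)%E).
    apply: gt0_ler_poweR => //; rewrite ?invr_ge0// in_itv/= leey andbT//.
    by rewrite integral_ge0// => y _; rewrite lee_fin sqr_ge0.
  by rewrite lee_pemull ?poweR_ge0// lee_fin ler1n.
apply: gt0_ler_poweR => //; rewrite ?invr_ge0// in_itv/= leey andbT//;
  by rewrite integral_ge0// => y _; rewrite lee_fin sqr_ge0.
Qed.
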